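(* Let $b$ be a positive integer and let $\Gamma$ be the cartesian product $K_b\square K_b$. There exists a vertex- and edge-transitive group $G\le\mathrm{Aut}(\Gamma)$ with a nontrivial, vertex-intransitive, normal subgroup $N$ if and only if $b$ is a prime power. Moreover, in this case each such subgroup $N$ corresponds to a complete normal quotient $\Gamma_N\cong K_b$.
   Context: $K_b\square K_b$ is the graph whose vertices are the pairs $(i,j)$ with $i,j\in\mathbb{Z}_b$, where $(i,j)$ and $(i',j')$ are adjacent if and only if $i=i'$ or $j=j'$ but not both. Edge-transitive means transitive on undirected edges. A prime power is a number $p^a$ with $p$ prime and $a\ge 1$. Quotient graph: if $G\le\mathrm{Aut}(\Gamma)$ is vertex-transitive and $1\neq N\triangleleft G$ is intransitive on $V(\Gamma)$, then $\Gamma_N$ is the graph whose vertices are the orbits of $N$ on $V(\Gamma)$, two distinct orbits $B,B'$ being adjacent if and only if some vertex of $B$ is adjacent in $\Gamma$ to some vertex of $B'$. *)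

(* Defs.v *)
From mathcomp Require Import all_boot all_fingroup.

Set Implicit Arguments.
Unset Strict Implicit.
Unset Printing Implicit Defensive.

Import GroupScope.

(* A finite simple graph is given by its adjacency relation e : rel T, assumed
   symmetric and irreflexive; this is proved below for the graphs used here. *)

Section Graphs.

Variable T : finType.
Implicit Types (e : rel T) (G N : {group {perm T}}).

Definition graph_aut e : {set {perm T}} :=
  [set s : {perm T} | [forall x, forall y, e (s x) (s y) == e x y]].

Lemma graph_autP e (s : {perm T}) :
  reflect (forall x y, e (s x) (s y) = e x y) (s \in graph_aut e).
Proof.
rewrite inE; apply: (iffP forallP) => [H x y | H x].
  by apply/eqP; exact: (forallP (H x) y).
by apply/forallP => y; apply/eqP.
Qed.

Lemma graph_aut_group_set e : group_set (graph_aut e).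
Proof.
apply/group_setP; split=> [|s t /graph_autP hs /graph_autP ht].
  by apply/graph_autP => x y; rewrite !perm1.
by apply/graph_autP => x y; rewrite !permM ht hs.
Qed.

Canonical graph_aut_group e := Group (graph_aut_group_set e).

Definition edges e : {set {set T}} :=
  [set [set u.1; u.2] | u : T * T & e u.1 u.2].

Definition vertex_transitive G : bool := [transitive G, on [set: T] | 'P].

(* Not [transitive G, on edges e | 'P^*], which is false on an empty set of
   edges. *)
Definition edge_transitive e G : Prop :=
  {in edges e &, forall E F, F \in orbit 'P^* G E}.

Definition orbit_of N : finType :=
  {B : {set T} | B \in [set orbit 'P N x | x : T]}.

Definition quotient_adj e N : rel (orbit_of N) :=
  fun B C => (B != C) && [exists x in val B, exists y in val C, e x y].

End Graphs.

Arguments quotient_adj {T} e N.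

Definition graph_iso (T1 T2 : finType) (e1 : rel T1) (e2 : rel T2) : Prop :=
  exists2 f : T1 -> T2, bijective f & forall x y, e2 (f x) (f y) = e1 x y.

Definition complete_adj (b : nat) : rel 'I_b := fun i j => i != j.
Arguments complete_adj : clear implicits.

(* The coordinates only serve as labels, so 'I_b stands for Z/b; 'Z_b would
   have two elements when b = 1. *)
Definition square_vertex (b : nat) : finType := ('I_b * 'I_b)%type.

Definition square_adj (b : nat) : rel (square_vertex b) :=
  fun u v => (u.1 == v.1) (+) (u.2 == v.2).
Arguments square_adj : clear implicits.

Lemma complete_adj_sym b : symmetric (complete_adj b).
Proof. by move=> i j; rewrite /complete_adj eq_sym. Qed.

Lemma complete_adj_irr b : irreflexive (complete_adj b).
Proof. by move=> i; rewrite /complete_adj eqxx. Qed.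

Lemma square_adj_sym b : symmetric (square_adj b).
Proof. by move=> u v; rewrite /square_adj !(eq_sym u.1, eq_sym u.2). Qed.

Lemma square_adj_irr b : irreflexive (square_adj b).
Proof. by move=> u; rewrite /square_adj !eqxx. Qed.

Lemma quotient_adj_sym (T : finType) (e : rel T) (N : {group {perm T}}) :
  symmetric e -> symmetric (quotient_adj e N).
Proof.
move=> se B C; rewrite /quotient_adj eq_sym; congr (_ && _).
by apply/exists_inP/exists_inP => -[x xB /exists_inP[y yC exy]];
  exists y => //; apply/exists_inP; exists x => //; rewrite se.
Qed.

Lemma quotient_adj_irr (T : finType) (e : rel T) (N : {group {perm T}}) :
  irreflexive (quotient_adj e N).
Proof. by move=> B; rewrite /quotient_adj eqxx. Qed.

Definition vertex_edge_transitive_aut (T : finType) (e : rel T)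
    (G : {group {perm T}}) : Prop :=
  [/\ G \subset graph_aut e, vertex_transitive G & edge_transitive e G].

Definition nontrivial_intransitive_normal (T : finType)
    (G N : {group {perm T}}) : Prop :=
  [/\ N <| G, N :!=: 1 & ~~ vertex_transitive N].

Definition prime_power (n : nat) : Prop :=
  exists p a : nat, [/\ prime p, (0 < a)%N & n = (p ^ a)%N].

(* Main.v *)
Require Import Defs.
From mathcomp Require Import all_boot all_fingroup all_algebra.
From mathcomp Require Import all_solvable all_field.

(** Every automorphism of the b x b rook graph either keeps the two families of
    lines (rows and columns) or exchanges them ([square_aut_twists]): whether
    two edges at a vertex lie on one line is visible in the graph, and the
    graph is connected.

    Let N be a nontrivial intransitive normal subgroup of a vertex- and
    edge-transitive G.  No N-orbit contains an edge, for otherwise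
    edge-transitivity would put every edge inside an N-orbit, and connectedness
    would leave only one orbit ([normal_orbit_no_edge]).  Let M be the subgroup
    of the elements of N that keep the line families.
    - M is nontrivial ([straight_part_neq1]).  Otherwise N has order 2, so its
      generator commutes with G; but an involution exchanging rows and columns
      fixes a vertex, hence by transitivity every vertex.
    - M is semiregular on rows ([straight_part_fix_row]): an element fixing a
      row moves each of its vertices within the row, that is, within the
      row and the N-orbit at once, so not at all; it then fixes every column,
      and by the same argument every vertex.
    - M is transitive on rows ([straight_part_transitive]): if some m in M
      moves one row to another, conjugating m by elements of G that carry
      edges to edges moves any row to any other.
    So M is regular on the b rows, and the conjugation argument shows moreover
    that all nontrivial elements of M have the same order.  By Cauchy's theorem
    b = #|M| is then a power of a single prime.  Also every N-orbit meets every
    row, and only once because it contains no edge; a row is thus a complete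
    set of representatives of the orbits, and the quotient is complete
    ([square_quotient_complete]).

    Conversely, for a prime power b label rows and columns by the field F with
    b elements.  The diagonal translations (x, y) -> (x + t, y + t) form an
    intransitive group, and its normaliser among the automorphisms contains all
    maps (x, y) -> (c x + t1, c y + t2) and the swap, which are already
    transitive on arcs ([normaliser_arc]). *)

Set Implicit Arguments.
Unset Strict Implicit.
Unset Printing Implicit Defensive.

(** * Automorphisms of the rook graph *)

Section Automorphisms.

Variable b : nat.
Local Notation V := (square_vertex b).
Local Notation adj := (square_adj b).
Implicit Types (s t : {perm V}) (u v w : V).

Definition coord (d : bool) u : 'I_b := if d then u.2 else u.1.

(** The permutation maps lines to lines, keeping the two families when [c] is
    false and exchanging them when [c] is true.  Booleans make the composition
    law an exclusive or. *)
Definition twists (c : bool) s : bool :=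
  [forall d, forall u, forall v,
    (coord d (s u) == coord d (s v)) == (coord (c (+) d) u == coord (c (+) d) v)].

Lemma twistsP c s :
  reflect (forall d u v, (coord d (s u) == coord d (s v)) =
                         (coord (c (+) d) u == coord (c (+) d) v))
          (twists c s).
Proof.
apply: (iffP idP) => [/forallP + d u v | H].
  by move=> /(_ d)/forallP/(_ u)/forallP/(_ v)/eqP.
by do 3!apply/forallP => ?; apply/eqP.
Qed.

Lemma coord_inj u v : (forall d, coord d u = coord d v) -> u = v.
Proof. by move: u v => [i j] [k l] H; move: (H false) (H true) => /= -> ->. Qed.

Lemma twistsM c d s t : twists c s -> twists d t -> twists (c (+) d) (s * t)%g.
Proof.
move=> /twistsP Hs /twistsP Ht; apply/twistsP => e u v.
by rewrite !permM Ht Hs addbA.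
Qed.

Lemma twistsV c s : twists c s -> twists c s^-1%g.
Proof.
move=> /twistsP Hs; apply/twistsP => d u v.
by rewrite -{2}(permKV s u) -{2}(permKV s v) Hs addbA addbb.
Qed.

Lemma twistsJ c d s t : twists c s -> twists d t -> twists c (s ^ t)%g.
Proof.
move=> Hs Ht; rewrite (_ : c = d (+) (c (+) d)); last by case: c d {Hs Ht} => -[].
exact: twistsM (twistsV Ht) (twistsM Hs Ht).
Qed.

(** Connectedness in the form of an induction: a reflexive and transitive
    relation containing adjacency relates any two vertices, because the corner
    (u.1, v.2) joins u to v by steps along two lines. *)
Lemma square_connected (P : V -> V -> Prop) :
    (forall u, P u u) -> (forall u v w, P u v -> P v w -> P u w) ->
    (forall u v, adj u v -> P u v) -> forall u v, P u v.
Proof.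
move=> P0 PT Padj u v.
have [e1|ne1] := eqVneq u.1 v.1.
  have [e2|ne2] := eqVneq u.2 v.2; last first.
    by apply: Padj; rewrite /square_adj e1 eqxx (negPf ne2).
  by rewrite (_ : u = v) //; apply: coord_inj => -[].
have Pr: P (u.1, v.2) v.
  by apply: Padj; rewrite /square_adj /= eqxx (negPf ne1).
apply: PT Pr; have [<-|ne2] := eqVneq u.2 v.2; first by case: (u).
by apply: Padj; rewrite /square_adj /= eqxx (negPf ne2).
Qed.

(** The right-hand side mentions adjacency only, so automorphisms preserve the
    relation between edges [u v] and [u w] of lying on one line. *)
Lemma same_lineE u v w : adj u v -> adj u w ->
  (u.1 == v.1) (+) (u.1 == w.1) = ~~ ((v == w) || adj v w).
Proof.
case: u v w => [i j] [k l] [m n]; rewrite /square_adj /= xpair_eqE.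
have [?|ik] := eqVneq i k; have [?|im] := eqVneq i m; subst; rewrite ?eqxx /=;
  have [?|jl] := eqVneq j l; have [?|jn] := eqVneq j n; subst; rewrite ?eqxx //=.
- by case: (l == n).
- by rewrite (negPf im) eq_sym (negPf jl).
- by rewrite eq_sym (negPf ik) (negPf jn).
- by case: (k == m).
Qed.

(** Call an edge turned by the automorphism if its image has the other
    direction.  By [same_lineE] two edges at a common vertex are both turned or
    both not turned, so all edges agree by connectedness. *)
Lemma square_aut_twists s : s \in graph_aut adj -> exists c, twists c s.
Proof.
move=> /graph_autP aut_s.
pose k u v := ((s u).1 == (s v).1) (+) (u.1 == v.1).
have kC u v : k u v = k v u by rewrite /k (eq_sym u.1) (eq_sym (s u).1).
have k_star u v w : adj u v -> adj u w -> k u v = k u w.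
  move=> uv uw; have := @same_lineE (s u) (s v) (s w).
  rewrite (inj_eq perm_inj) !aut_s => /(_ uv uw); rewrite -(same_lineE uv uw).
  by rewrite /k; do 4![case: (_ == _)].
have [c k_c] : exists c, forall u v, adj u v -> k u v = c.
  have [/existsP[u0 /existsP[v0 uv0]] | no_edge] :=
    boolP [exists u, exists v, adj u v].
    exists (k u0 v0) => u v; move: v.
    pose P x y := (forall v, adj x v -> k x v = k u0 v0) ->
                  (forall v, adj y v -> k y v = k u0 v0).
    suff /(_ u0 u): forall x y, P x y by apply => v u0v; exact: k_star.
    apply: square_connected => [x kx|x y z xy yz kx|x y xy kx v yv] //.
      exact: yz (xy kx).
    rewrite -(kx y xy) (kC x); apply: k_star => //.
    by rewrite square_adj_sym.
  exists false => u v uv; case/existsP: no_edge.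
  by exists u; apply/existsP; exists v.
exists c; apply/twistsP => d u v.
have [<-|ne_uv] := eqVneq u v; first by rewrite !eqxx.
have ne_suv : s u != s v by rewrite (inj_eq perm_inj).
(* For adjacent u and v the claim is the definition of c; distinct nonadjacent
   vertices agree in no coordinate, before and after applying s. *)
move: (k_c u v) (aut_s u v) ne_uv ne_suv.
rewrite /k /square_adj {k k_c kC k_star aut_s}.
case: (s u) (s v) => [i j] [k l]; case: u v => [m n] [o p].
rewrite !xpair_eqE /coord /=.
by case: d c => -[] /=; do 4![case: (_ == _)] => //= /(_ isT).
Qed.

Definition straight : {set {perm V}} := [set s | twists false s].

Lemma straight_group_set : group_set straight.
Proof.
apply/group_setP; split=> [|s t]; rewrite !inE; last exact: (@twistsM false false).
by apply/twistsP => d u v; rewrite !perm1.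
Qed.

Canonical straight_group := Group straight_group_set.

Lemma straightP s :
  reflect (forall d u v, (coord d (s u) == coord d (s v)) =
                         (coord d u == coord d v))
          (s \in straight).
Proof. by rewrite inE; apply: (iffP (twistsP _ _)). Qed.

End Automorphisms.

(** * Nontrivial intransitive normal subgroups *)

Lemma edge_transitive_maps (T : finType) (e : rel T) (G : {group {perm T}})
    (u v x y : T) :
    edge_transitive e G -> e u v -> e x y ->
  exists2 g : {perm T}, g \in G & (g u = x /\ g v = y) \/ (g u = y /\ g v = x).
Proof.
move=> tG uv xy; have edge p q : e p q -> [set p; q] \in edges e.
  by move=> pq; apply/imsetP; exists (p, q); rewrite ?inE.
have /orbitP[g Gg /= /setP gE] := tG _ _ (edge _ _ uv) (edge _ _ xy).
exists g => //; rewrite setactE imsetU1 imset_set1 in gE.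
move: (gE (g u)) (gE (g v)) (gE x) (gE y); rewrite !inE /= !apermE !eqxx !orbT /=.
move=> /esym/orP[]/eqP gu /esym/orP[]/eqP gv /orP[]/eqP gx /orP[]/eqP gy;
  by [left; split; congruence | right; split; congruence].
Qed.

Lemma perm_neq1_moves (T : finType) (s : {perm T}) :
  s != 1%g -> exists u, s u != u.
Proof.
move=> s1; apply/existsP; apply: contraR s1 => /existsPn fix_s.
by apply/eqP/permP => u; rewrite perm1; apply/eqP/negPn/fix_s.
Qed.

Section NormalSubgroup.

Import GroupScope.

Variable b : nat.
Local Notation V := (square_vertex b).
Local Notation adj := (square_adj b).
Variables G N : {group {perm V}}.
Hypothesis Gve : vertex_edge_transitive_aut adj G.
Hypothesis Nni : nontrivial_intransitive_normal G N.
Implicit Types (g m n : {perm V}) (u v w x y : V).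

Lemma conjN g n : g \in G -> n \in N -> n ^ g \in N.
Proof.
by case: Nni => /andP[_ /subsetP nNG] _ _ Gg Nn; rewrite memJ_norm ?nNG.
Qed.

(** If some orbit of [N] contained an edge, then so would its images under [G];
    by edge-transitivity every edge would lie inside an orbit, and [N] would be
    transitive. *)
Lemma normal_orbit_no_edge n v : n \in N -> ~~ adj v (n v).
Proof.
move=> Nn; apply/negP => vnv; case: Nni => _ _ /negP; apply.
have [_ _ eG] := Gve.
have conn: forall x y, y \in orbit 'P N x.
  apply: square_connected => [x|x y z xy yz|x y xy]; first exact: orbit_refl.
    exact: orbit_trans yz xy.
  have [g Gg gvn] := edge_transitive_maps eG vnv xy.
  have : g (n v) \in orbit 'P N (g v).
    by rewrite -permJ -apermE mem_orbit ?conjN.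
  by case: gvn => -[-> ->] //; rewrite orbit_sym.
by apply/imsetP; exists v => //; apply/setP => x; rewrite inE conn.
Qed.

Local Notation M := (N :&: straight b).

Lemma G_twists g : g \in G -> exists c, twists c g.
Proof. by case: Gve => /subsetP sG _ _ /sG; apply: square_aut_twists. Qed.

(** An involution exchanging rows and columns interchanges the row of [u] with
    the column of [n u], so it fixes the vertex where these two lines meet. *)
Lemma twists_involution_fix n u :
  twists true n -> n * n = 1 -> n (u.1, (n u).2) = (u.1, (n u).2).
Proof.
move=> /twistsP n_cross nn1.
have nnu : n (n u) = u by rewrite -permM nn1 perm1.
apply: coord_inj => -[]; apply/eqP.
  by rewrite (n_cross true (u.1, (n u).2) u).
by rewrite -[in X in _ == X]nnu (n_cross false (u.1, (n u).2) (n u)).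
Qed.

(** If every nontrivial element of [N] exchanged rows and columns, the product
    of any two of them would be trivial; so [N] would have a single nontrivial
    element, an involution commuting with [G].  Its fixed vertices would form a
    nonempty set invariant under [G], hence the whole vertex set. *)
Lemma straight_part_neq1 : M :!=: 1.
Proof.
have [sGA tG _] := Gve; have [/andP[sNG _] ntN intN] := Nni.
apply/eqP => M1.
have crossN n : n \in N -> n != 1 -> twists true n.
  move=> Nn; have [[] // c0] := G_twists (subsetP sNG n Nn).
  by case/eqP; apply/set1P; rewrite -[[set 1]]M1 !inE Nn.
have [n Nn n1] := trivgPn _ ntN.
have prodN m : m \in N -> m != 1 -> m * n = 1.
  move=> Nm m1; apply/set1P; rewrite -[[set 1]]M1 !inE groupM //=.
  by rewrite (twistsM (crossN m _ _) (crossN n _ _)).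
have n_fix := twists_involution_fix _ (crossN n Nn n1) (prodN n Nn n1).
case/negP: (n1); apply/eqP/permP => v; rewrite perm1.
pose x := (v.1, (n v).2); have nx : n x = x := n_fix v.
have [g Gg /= ->] := atransP2 tG (in_setT x) (in_setT v).
have ngn : n ^ g = n by apply: (mulIg n); rewrite !prodN ?conjN ?conjg_eq1.
by rewrite apermE -{1}ngn permJ nx.
Qed.

(** Two distinct vertices of a row are adjacent, so if [m] maps the row of [v]
    to itself, it fixes each vertex of this row by [normal_orbit_no_edge].  Each
    column meets the row, so it is mapped to itself, and hence fixed pointwise
    for the same reason. *)
Lemma straight_part_fix_row m v : m \in M -> (m v).1 = v.1 -> m = 1.
Proof.
case/setIP=> Nm /straightP Sm mv.
have fix1 w : w.1 = v.1 -> m w = w.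
  move=> wv; have mw1 : (m w).1 = w.1.
    by rewrite wv -mv; apply/eqP; rewrite (Sm false) /= wv.
  apply: coord_inj => -[] //=; apply/eqP/negPn.
  apply: contra (normal_orbit_no_edge w Nm).
  by rewrite /square_adj mw1 eqxx eq_sym.
apply/permP => x; rewrite perm1.
have mx2 : (m x).2 = x.2.
  have fix2 : (m (v.1, x.2)).2 = x.2 by rewrite fix1.
  by rewrite -[RHS]fix2; apply/eqP; rewrite (Sm true).
apply: coord_inj => -[] //=; apply/eqP/negPn.
apply: contra (normal_orbit_no_edge x Nm).
by rewrite /square_adj mx2 eqxx eq_sym addbT.
Qed.

(** A conjugate of [m0] or of its inverse does it: [m0] moves the row of [u] to
    the row of [v], and edge-transitivity provides an element of [G] carrying
    the edge [u v] to an edge of the column of [u] that joins the rows of [u]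
    and [w].  The order of the new element is what forces all orders in
    [straight_part_same_order] to agree. *)
Lemma straight_part_transitive m0 u w : m0 \in M -> m0 != 1 -> u.1 != w.1 ->
  exists2 m, m \in M & #[m] = #[m0] /\ (m u).1 = w.1.
Proof.
move=> Mm0 m01 uw; have [_ _ eG] := Gve.
have Sm0 : twists false m0 by case/setIP: Mm0; rewrite !inE.
have MJ g : g \in G -> m0 ^ g \in M.
  move=> Gg; have [c gc] := G_twists Gg; case/setIP: Mm0 => Nm _.
  by rewrite !inE conjN //= (twistsJ Sm0 gc).
pose v := ((m0 u).1, u.2); pose w' := (w.1, u.2).
have uv : adj u v.
  rewrite /square_adj eqxx addbT /= eq_sym.
  by apply: contra m01 => /eqP/(straight_part_fix_row Mm0)/eqP.
have uw' : adj u w' by rewrite /square_adj eqxx addbT.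
have [g Gg gE] := edge_transitive_maps eG uv uw'.
(* Both edges lie in columns, so g cannot exchange rows and columns. *)
have [[] /twistsP g_c] := G_twists Gg.
  have := g_c true u v; rewrite /= [RHS]negbTE; last first.
    by move: uv; rewrite /square_adj eqxx addbT.
  by case: gE => -[-> ->]; rewrite eqxx.
have m0gE : ((m0 ^ g) (g u)).1 = (g v).1.
  by rewrite permJ; apply/eqP; rewrite (g_c false).
(* An undirected edge may be mapped with its ends interchanged, in which case
   the inverse of the conjugate is the element wanted. *)
case: gE => -[gu gv].
  by rewrite gu gv in m0gE; exists (m0 ^ g); rewrite ?MJ ?orderJ.
exists (m0 ^ g)^-1; rewrite ?groupV ?MJ // orderV orderJ; split=> //.
have /twistsP V_c: twists false (m0 ^ g)^-1.
  by case/setIP: (MJ g Gg); rewrite !inE => _ /twistsV.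
have -> : w.1 = coord false ((m0 ^ g)^-1 ((m0 ^ g) w')) by rewrite permK.
apply/eqP; rewrite (V_c false) /=.
by rewrite gu gv in m0gE; rewrite m0gE.
Qed.

Lemma straight_part_row_inj u :
  {in M &, injective (fun m : {perm V} => (m u).1)}.
Proof.
move=> m n Mm Mn mn; have [_ /straightP nV] := setIP (groupVr Mn).
apply/eqP; rewrite eq_mulgV1; apply/eqP/(@straight_part_fix_row _ u).
  by rewrite groupM ?groupV.
rewrite permM; apply/eqP; rewrite -[in X in _ == X](permK n u) (nV false) /=.
by rewrite mn.
Qed.

(** Some conjugate of [m] or of its inverse moves the row of a vertex to the
    same row as [n] does, and so equals [n] by semiregularity. *)
Lemma straight_part_same_order m n :
  m \in M -> n \in M -> m != 1 -> n != 1 -> #[m] = #[n].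
Proof.
move=> Mm Mn m1 n1; have [u _] := perm_neq1_moves m1.
have un : u.1 != (n u).1.
  by apply: contra n1 => /eqP/esym/(straight_part_fix_row Mn)/eqP.
have [x Mx [<- xu]] := straight_part_transitive Mm m1 un.
by congr #[_]; apply: straight_part_row_inj xu.
Qed.

Lemma card_straight_part : #|M| = b.
Proof.
have [m Mm m1] := trivgPn _ straight_part_neq1.
have [u _] := perm_neq1_moves m1.
rewrite -[RHS]card_ord -cardsT -(card_in_imset (straight_part_row_inj (u := u))).
apply: eq_card => i; rewrite in_setT; apply/imsetP.
have [ui|ui] := eqVneq u.1 i; first by exists 1; rewrite ?group1 ?perm1.
have [x Mx [_ xu]] := @straight_part_transitive m u (i, i) Mm m1 ui.
by exists x.
Qed.

(** For a prime q dividing #|M|, Cauchy's theorem gives an element of order q;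
    as all nontrivial elements have the same order, only one q is possible. *)
Lemma square_normal_prime_power : prime_power b.
Proof.
have [m Mm m1] := trivgPn _ straight_part_neq1.
have M_gt1 : (1 < #|M|)%N by rewrite cardG_gt1 straight_part_neq1.
pose p := pdiv #|M|; have p_pr : prime p by apply: pdiv_prime.
have ord_p n q : n \in M -> #[n] = q -> prime q -> #[m] = q.
  move=> Mn <- q_pr; apply: straight_part_same_order => //.
  by apply: contraTneq q_pr => ->; rewrite order1.
have pM : p.-group M.
  apply/pgroupP => q q_pr /(Cauchy q_pr)[y My oy].
  have [x Mx ox] := Cauchy p_pr (pdiv_dvd #|M|).
  by rewrite inE -(ord_p y q) // (ord_p x p).
have [a Ma] := p_natP pM; exists p, a; split=> //; last first.
  by rewrite -Ma card_straight_part.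
by case: a Ma M_gt1 => // ->.
Qed.

(** The vertices of one row represent the orbits of [N]: no orbit contains two
    of them since they are adjacent, and every orbit contains one since [M] is
    transitive on rows. *)
Lemma square_quotient_complete :
  graph_iso (quotient_adj adj N) (complete_adj b).
Proof.
have [m Mm m1] := trivgPn _ straight_part_neq1.
have [v0 _] := perm_neq1_moves m1.
have orbP u : orbit 'P N u \in [set orbit 'P N x | x : V] by apply: imset_f.
pose h (j : 'I_b) : orbit_of N := Sub (orbit 'P N (v0.1, j)) (orbP _).
have h_inj : injective h.
  move=> i j /(congr1 val)/= hij.
  have: (v0.1, j) \in orbit 'P N (v0.1, i) by rewrite hij orbit_refl.
  case/orbitP=> n Nn /= nij; apply/eqP/negPn.
  apply: contra (normal_orbit_no_edge (v0.1, i) Nn) => ij.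
  by rewrite -apermE nij /square_adj eqxx.
have h_surj B : B \in codom h.
  case: B => B B_orb; have /imsetP[v _ defB] := B_orb.
  have [x Nx xv] : exists2 x, x \in N & (x v).1 = v0.1.
    have [vv|vv] := eqVneq v.1 v0.1; first by exists 1; rewrite ?group1 ?perm1.
    have [x /setIP[Nx _] [_ xv]] := straight_part_transitive Mm m1 vv.
    by exists x.
  apply/codomP; exists (x v).2; apply: val_inj => /=; rewrite defB -xv.
  rewrite -surjective_pairing; apply/orbit_eqP; rewrite orbit_sym.
  by rewrite -apermE mem_orbit.
pose f B := iinv (h_surj B).
have fK : cancel f h by move=> B; apply: f_iinv.
have hK : cancel h f by move=> i; apply: h_inj; rewrite fK.
exists f; first by exists h.
move=> B C; rewrite -(fK B) -(fK C) !hK.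
rewrite /quotient_adj /complete_adj (inj_eq h_inj).
have [//|ij] := eqVneq; apply/esym.
apply/exists_inP; exists (v0.1, f B); first exact: orbit_refl.
apply/exists_inP; exists (v0.1, f C); first exact: orbit_refl.
by rewrite /square_adj eqxx /= ij.
Qed.

End NormalSubgroup.

(** * The construction over a finite field *)

Section FieldSquare.

Import GRing.Theory.
Local Open Scope ring_scope.

Variables (b : nat) (F : finFieldType) (phi : 'I_b -> F) (psi : F -> 'I_b).
Hypotheses (phiK : cancel phi psi) (psiK : cancel psi phi).
Local Notation V := (square_vertex b).
Local Notation adj := (square_adj b).

Definition affine_vertex (c : F) (t : F * F) (u : V) : V :=
  (psi (c * phi u.1 + t.1), psi (c * phi u.2 + t.2)).

Lemma affine_coord_inj (c t : F) :
  c != 0 -> injective (fun i => psi (c * phi i + t)).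
Proof. by move=> c0 i j /(can_inj psiK) /addIr /(mulfI c0) /(can_inj phiK). Qed.

Lemma affine_vertex_inj c t : c != 0 -> injective (affine_vertex c t).
Proof.
by move=> c0 [i j] [k l] [] /(affine_coord_inj c0) -> /(affine_coord_inj c0) ->.
Qed.

Definition affine c t (c0 : c != 0) : {perm V} := perm (@affine_vertex_inj c t c0).

Lemma affine_aut c t (c0 : c != 0) : affine t c0 \in graph_aut adj.
Proof.
apply/graph_autP => u v.
by rewrite /square_adj !permE /= !(inj_eq (@affine_coord_inj c _ c0)).
Qed.

Lemma swap_inj : injective (fun u : V => (u.2, u.1) : V).
Proof. by move=> [i j] [k l] [-> ->]. Qed.

Definition swap : {perm V} := perm swap_inj.

Lemma swap_aut : swap \in graph_aut adj.
Proof. by apply/graph_autP => u v; rewrite /square_adj !permE /= addbC. Qed.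

Definition translation (t : F) : {perm V} := affine (t, t) (oner_neq0 F).

Definition translations : {set {perm V}} := [set translation t | t : F].

Lemma translationE t u : translation t u = (psi (phi u.1 + t), psi (phi u.2 + t)).
Proof. by rewrite permE /affine_vertex !mul1r. Qed.

Lemma translationM s t : (translation s * translation t)%g = translation (s + t).
Proof. by apply/permP => u; rewrite permM !translationE /= !psiK !addrA. Qed.

Lemma translations_group_set : group_set translations.
Proof.
apply/group_setP; split=> [|_ _ /imsetP[s _ ->] /imsetP[t _ ->]].
  apply/imsetP; exists 0 => //; apply/permP => u.
  by rewrite perm1 translationE !addr0 !phiK -surjective_pairing.
by rewrite translationM imset_f.
Qed.

Canonical translations_group := Group translations_group_set.

(** Taking the whole normaliser instead of the group generated by the maps
    below makes normality of the translations automatic: only the presence of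
    these maps has to be checked. *)
Definition translation_normaliser := ('N_(graph_aut adj)(translations))%G.
Local Notation G := translation_normaliser.
Local Notation N := translations_group.

Lemma conj_in_normaliser (s : {perm V}) (k : F -> F) :
    s \in graph_aut adj ->
    (forall t, (translation t ^ s)%g = translation (k t)) ->
  s \in G.
Proof.
move=> As Js; rewrite inE As; apply/normP/eqP; rewrite eqEcard cardJg leqnn andbT.
apply/subsetP => _ /imsetP[_ /imsetP[t _ ->] ->].
by rewrite Js imset_f.
Qed.

Lemma affine_normaliser c t (c0 : c != 0) : affine t c0 \in G.
Proof.
apply: (@conj_in_normaliser _ ( *%R c)); first exact: affine_aut.
move=> s; apply: (mulgI (affine t c0)); rewrite -conjgC.
apply/permP => u; rewrite !permM !translationE !permE /affine_vertex /= !psiK.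
by rewrite !mulrDr ![_ + t.1]addrAC ![_ + t.2]addrAC.
Qed.

Lemma swap_normaliser : swap \in G.
Proof.
apply: (@conj_in_normaliser _ id); first exact: swap_aut.
move=> s; apply: (mulgI swap); rewrite -conjgC.
by apply/permP => u; rewrite !permM !translationE !permE.
Qed.

(** Scaling by the difference of the two distinct coordinates of [u] and [v] and
    translating gives the arcs within one row; the swap gives the others. *)
Lemma normaliser_arc u v : adj u v ->
  exists2 g : {perm V}, g \in G & g (psi 0, psi 0) = u /\ g (psi 0, psi 1) = v.
Proof.
move=> uv; have [e1 | ne1] := eqVneq u.1 v.1.
  have d0 : phi v.2 - phi u.2 != 0.
    rewrite subr_eq0 (can_eq phiK) eq_sym.
    by move: uv; rewrite /square_adj e1 eqxx.
  exists (affine (phi u.1, phi u.2) d0); first exact: affine_normaliser.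
  rewrite !permE /affine_vertex /= !psiK !mulr0 mulr1 !add0r subrK !phiK.
  by rewrite {2}e1 -!surjective_pairing.
have d0 : phi v.1 - phi u.1 != 0 by rewrite subr_eq0 (can_eq phiK) eq_sym.
have e2 : u.2 = v.2 by apply/eqP; move: uv; rewrite /square_adj (negPf ne1).
exists (swap * affine (phi u.1, phi u.2) d0)%g.
  by rewrite groupM ?affine_normaliser ?swap_normaliser.
rewrite !permM !permE /affine_vertex /= !psiK !mulr0 mulr1 !add0r subrK !phiK.
by rewrite {2}e2 -!surjective_pairing.
Qed.

Lemma normaliser_vertex_edge_transitive : vertex_edge_transitive_aut adj G.
Proof.
split; first exact: subsetIl.
  apply/imsetP; exists (psi 0, psi 0) => //; apply/setP => u.
  rewrite in_setT; apply/esym.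
  apply/orbitP; exists (affine (phi u.1, phi u.2) (oner_neq0 F)).
    exact: affine_normaliser.
  rewrite /= apermE permE /affine_vertex /= !psiK mul1r !add0r !phiK.
  by rewrite -surjective_pairing.
pose E0 : {set V} := [set (psi 0, psi 0); (psi 0, psi 1)].
have orbE E : E \in edges adj -> E \in orbit 'P^* G E0.
  case/imsetP=> -[u v]; rewrite inE /= => /normaliser_arc[g Gg [gu gv]] ->.
  apply/orbitP; exists g; rewrite //= setactE imsetU1 imset_set1.
  by rewrite /= !apermE gu gv.
move=> E E' /orbE E_orb /orbE E'_orb; apply: orbit_trans E'_orb _.
by rewrite orbit_sym.
Qed.

Lemma translations_nontrivial_intransitive_normal :
  nontrivial_intransitive_normal G N.
Proof.
split.
- apply/andP; split; last exact: subsetIr.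
  by apply/subsetP => _ /imsetP[t _ ->]; apply: affine_normaliser.
- apply/trivgPn; exists (translation 1); first exact: imset_f.
  apply/eqP => /permP/(_ (psi 0, psi 0)).
  rewrite translationE perm1 /= psiK add0r => -[/(can_inj psiK)/eqP].
  by rewrite oner_eq0.
apply/negP => /atransP2 /(_ (psi 0, psi 0) (psi 0, psi 1)) [] // _ /imsetP[t _ ->].
rewrite /= apermE translationE /= psiK add0r.
by case=> /(can_inj psiK) <- /(can_inj psiK)/eqP; rewrite oner_eq0.
Qed.

End FieldSquare.

Theorem corollary4p5 (b : nat) (hb : (0 < b)%N) :
  ((exists G : {group {perm square_vertex b}},
      vertex_edge_transitive_aut (square_adj b) G /\
      exists N : {group {perm square_vertex b}},
        nontrivial_intransitive_normal G N)
   <-> prime_power b)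
  /\
  (prime_power b ->
     forall G N : {group {perm square_vertex b}},
       vertex_edge_transitive_aut (square_adj b) G ->
       nontrivial_intransitive_normal G N ->
       graph_iso (quotient_adj (square_adj b) N) (complete_adj b)).
Proof.
split; last by move=> _ G N; apply: square_quotient_complete.
split=> [[G [Gve [N Nni]]] | [p [a [p_pr a_gt0 b_pa]]]].
  exact: square_normal_prime_power Gve Nni.
have [F _ cardF] := pPrimePowerField p_pr a_gt0.
have bF : b = #|F| by rewrite cardF.
pose phi (i : 'I_b) : F := enum_val (cast_ord bF i).
pose psi (x : F) : 'I_b := cast_ord (esym bF) (enum_rank x).
have phiK : cancel phi psi by move=> i; rewrite /psi enum_valK cast_ordK.
have psiK : cancel psi phi by move=> x; rewrite /phi cast_ordKV enum_rankK.
exists (translation_normaliser phiK psiK).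
split; first exact: normaliser_vertex_edge_transitive.
exists (translations_group phiK psiK).
exact: translations_nontrivial_intransitive_normal.
Qed.
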